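(* For every partition $\lambda\vdash n$ and every $j\in\{0,1,\dots,n-1\}$, the Eulerian quasisymmetric function $Q_{\lambda,j}$ is a symmetric function.
   Context: For $\sigma\in\mathfrak S_n$ in one-line notation $\sigma_1\cdots\sigma_n$, $\mathrm{Exc}(\sigma)=\{i\in[n-1]:\sigma_i>i\}$, $\mathrm{exc}=|\mathrm{Exc}|$. Order $\bar1<\dots<\bar n<1<\dots<n$; $\bar\sigma$ is $\sigma$ with $\sigma_i$ replaced by $\overline{\sigma_i}$ for $i\in\mathrm{Exc}(\sigma)$; $\mathrm{Exd}(\sigma)=\{i\in[n-1]:\bar\sigma_i>\bar\sigma_{i+1}\}$. $F_{S,n}=\sum x_{i_1}\cdots x_{i_n}$ over $i_1\ge\dots\ge i_n\ge1$ with $i_j>i_{j+1}$ for $j\in S$ (a formal power series in $x_1,x_2,\dots$). $Q_{\lambda,j}=\sum F_{\mathrm{Exd}(\sigma),n}$ over $\sigma\in\mathfrak S_n$ of cycle type $\lambda$ with $\mathrm{exc}(\sigma)=j$. *)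

(* Defs.v *)
From HB Require Import structures.
From mathcomp Require Import all_boot all_order all_fingroup all_algebra.
From mathcomp Require Import finmap multiset.
From mathcomp Require Import boolp classical_sets functions cardinality fsbigop.

Set Implicit Arguments.
Unset Strict Implicit.
Unset Printing Implicit Defensive.

Import Order.TTheory GRing.Theory.

Local Open Scope nat_scope.
Local Open Scope mset_scope.

(* A permutation of [n] is an element of 'S_n and all indices are shifted down
   by one: i : 'I_n stands for i + 1 in [n], and i : 'I_n.-1 for i + 1 in
   [n - 1].  [pos] is the inclusion of [n - 1] into [n] and [pos_next] is the
   successor map from [n - 1] to [n] (ordS never wraps around on its range). *)
Definition pos n (i : 'I_n.-1) : 'I_n := widen_ord (leq_pred n) i.
Definition pos_next n (i : 'I_n.-1) : 'I_n := ordS (pos i).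

Definition Exc n (s : 'S_n) : {set 'I_n.-1} := [set i | pos i < s (pos i)].

Definition exc n (s : 'S_n) : nat := #|Exc s|.

(* The alphabet bar 1 < ... < bar n < 1 < ... < n: the letter k is (true, k),
   the barred letter bar k is (false, k), ordered lexicographically. *)
Definition barred_letter n := (bool *l 'I_n)%type.

Definition bar_word n (s : 'S_n) (i : 'I_n) : barred_letter n :=
  (i \notin [set pos e | e in Exc s], s i).

Definition Exd n (s : 'S_n) : {set 'I_n.-1} :=
  [set i | (bar_word s (pos_next i) < bar_word s (pos i))%O].

(* The weakly decreasing list of the cycle lengths, fixed points included. *)
Definition cycle_type n (s : 'S_n) : seq nat :=
  sort geq [seq #|C| | C : {set 'I_n} in porbits s].

Definition is_partition_of (n : nat) (la : seq nat) : bool :=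
  [&& sorted geq la, 0 \notin la & sumn la == n].

(* Formal power series in countably many variables: i : nat stands for the
   variable x_{i+1}, a monomial is the multiset of the indices of its variables,
   and a series is the function giving the coefficient of each monomial.  The
   additive structure is the pointwise one. *)
Notation power_series := ({mset nat} -> int).

Definition monomial (m : {mset nat}) : power_series := fun m' => (m' == m)%:R%R.

Definition admissible n (S : {set 'I_n.-1}) (t : n.-tuple nat) : Prop :=
  (forall j : 'I_n.-1, tnth t (pos_next j) <= tnth t (pos j)) /\
  (forall j : 'I_n.-1, j \in S -> tnth t (pos_next j) < tnth t (pos j)).

(* The infinite sum of monomials is taken coefficientwise: for each m, at most
   one admissible sequence t contributes, so no sum below has infinite support
   (\sum_(_ \in _) would be 0 in that case). *)
Definition Fseries n (S : {set 'I_n.-1}) : power_series := fun m =>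
  (\sum_(t \in [set t : n.-tuple nat | admissible S t]%classic)
     monomial (seq_mset t) m)%R.

Definition Qseries n (la : seq nat) (j : nat) : power_series :=
  (\sum_(s : 'S_n | (cycle_type s == la) && (exc s == j)) Fseries (Exd s))%R.

(* The monomial obtained from m by substituting x_{w i} for x_i. *)
Definition rename_vars (w : nat -> nat) (m : {mset nat}) : {mset nat} :=
  seq_mset [seq w i | i <- m].

Definition bounded_degree (f : power_series) : Prop :=
  exists d : nat, forall m : {mset nat}, d < size m -> f m = 0%R.

Definition symmetric_function (f : power_series) : Prop :=
  bounded_degree f /\
  forall w : nat -> nat, bijective w ->
    forall m : {mset nat}, f (rename_vars w m) = f m.

(* Main.v *)
Require Import Defs.
From mathcomp Require Import all_boot all_order all_fingroup all_algebra cyclic.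
From mathcomp Require Import finmap multiset zify.
From mathcomp Require Import boolp classical_sets functions cardinality fsbigop.

(* A permutation s and an admissible sequence t are recorded by the coloring
   x |-> (t_x, barred iff x < s x) of the points of s.  The colorings so obtained
   are characterized by a local condition along the cycles (a barred letter is
   followed by one of smaller or equal absolute value, an unbarred one by one of
   larger or equal absolute value, fixed points are unbarred) and by the order of
   the points, which refines the lexicographic order of the words read along the
   cycles, as in the Gessel-Reutenauer bijection.  To exchange the variables x_k
   and x_(k+1), take every maximal segment of a cycle with absolute values in
   {k, k+1}, reverse its sequence of values and exchange the two values; the bar
   of a letter belongs to the step to the next letter and moves along with it.
   A cycle with all its absolute values in {k, k+1} has no distinguished place to
   reflect it, but there it suffices to exchange the two values and to flip the
   bar at each change of value, since there are as many ascents as descents.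
   This involution preserves s, the number of bars and the ties between cyclic
   words, so the points can be relabelled in the order of their new words,
   breaking ties by the old order. *)

Set Implicit Arguments.
Unset Strict Implicit.
Unset Printing Implicit Defensive.

Local Open Scope nat_scope.

Definition nswap (a b x : nat) : nat :=
  if x == a then b else if x == b then a else x.

Lemma nswapK a b : involutive (nswap a b).
Proof. by move=> x; rewrite /nswap; do 4?case: eqP => //; lia. Qed.

(** * Iterates of a permutation *)

Section PermIter.
Variables (T : finType) (s : {perm T}).

(** The order of the symmetric group is an exponent that works for all permutations at once, so
    words of different permutations can be compared over the same length, and inverses are iterates
    with a common exponent. *)
Definition period := #|[set: {perm T}]|.

Lemma period_gt0 : 0 < period.
Proof. exact: (cardG_gt0 [set: {perm T}]%G). Qed.

Lemma iter_period x : iter period s x = x.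
Proof.
rewrite -permX; suff -> : (s ^+ period = 1)%g by rewrite perm1.
apply: (@expg_cardG _ [set: {perm T}]%G); exact: finset.in_setT.
Qed.

Lemma iter_modn e x : iter e s x = iter (e %% period) s x.
Proof.
rewrite [in LHS](divn_eq e period) addnC iterD iterM; congr iter.
by elim: (e %/ period) => //= k ->; apply: iter_period.
Qed.

Lemma perm_invE x : (s^-1)%g x = iter period.-1 s x.
Proof.
by apply: (@perm_inj _ s); rewrite permKV -iterS prednK ?period_gt0 // iter_period.
Qed.

Lemma iter_perm_inv e x : iter e (s^-1)%g x = iter (e * period.-1) s x.
Proof. by rewrite iterM; apply: eq_iter => y; rewrite perm_invE. Qed.

Lemma iter_permK e : cancel (iter e s) (iter e (s^-1)%g).
Proof. by elim: e => // e IH x; rewrite iterSr /= permK IH. Qed.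

End PermIter.

(** * Maximal segments of cycles inside a set, and their reflection *)

Section Runs.
Variable T : finType.
Implicit Types (s : {perm T}) (K : {set T}).

Definition full s K i := [forall e : 'I_(period T), iter e s i \in K].

(** Number of steps from [i] before the orbit exits [K]; if it never exits, [find] returns the
    default [period T]. *)
Definition run s K i :=
  find (fun e => iter e.+1 s i \notin K) (iota 0 (period T)).

Lemma fullP s K i : reflect (forall e, iter e s i \in K) (full s K i).
Proof.
apply: (iffP forallP) => [H e|H e]; last exact: H.
rewrite iter_modn.
exact: (H (Ordinal (ltn_pmod e (period_gt0 T)))).
Qed.

Lemma full_in s K i : full s K i -> i \in K.
Proof. by move/fullP/(_ 0). Qed.

Lemma full_perm s K i : full s K (s i) = full s K i.
Proof.
apply/fullP/fullP => H e; last by rewrite -iterSr.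
by rewrite -(iter_period s i) -(prednK (period_gt0 T)) -iterD addnS iterSr.
Qed.

Lemma full_iter s K e i : full s K (iter e s i) = full s K i.
Proof. by elim: e => //= e IH; rewrite full_perm. Qed.

Lemma full_inv s K i : full (s^-1)%g K i = full s K i.
Proof.
have H u : full u K i -> full (u^-1)%g K i.
  by move/fullP=> H; apply/fullP => e; rewrite iter_perm_inv.
by apply/idP/idP => [/H|/H //]; rewrite invgK.
Qed.

Definition is_run s K i q :=
  iter q.+1 s i \notin K /\ forall e, e < q -> iter e.+1 s i \in K.

Lemma run_uniq s K i q r : is_run s K i q -> is_run s K i r -> q = r.
Proof.
move=> [q1 q2] [r1 r2]; case: (ltngtP q r) => //.
  by move=> /r2; rewrite (negbTE q1).
by move=> /q2; rewrite (negbTE r1).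
Qed.

Lemma runP s K i : ~~ full s K i -> is_run s K i (run s K i).
Proof.
(* Starting from [s i] turns an exit at index [e] into one at [e.+1], the index that [run] tests. *)
rewrite -full_perm => /forallPn [[e le] /=]; rewrite -iterSr => He.
have Hhas : has (fun e => iter e.+1 s i \notin K) (iota 0 (period T)).
  by apply/hasP; exists e => //; rewrite mem_iota.
split.
  have := nth_find 0 Hhas; rewrite nth_iota ?add0n // -[X in _ < X](size_iota 0).
  by rewrite -has_find.
move=> d ld; have := before_find 0 ld; rewrite nth_iota ?add0n.
  by move/negbFE.
by apply: (leq_trans ld); rewrite -[X in _ <= X](size_iota 0) find_size.
Qed.

Lemma runE s K i q : ~~ full s K i -> is_run s K i q -> run s K i = q.
Proof. by move=> /runP H1 H2; apply: run_uniq H1 H2. Qed.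

Lemma run_perm s K i : ~~ full s K i -> s i \in K ->
  run s K i = (run s K (s i)).+1.
Proof.
move=> nf Ki; apply: runE => //.
have [|H1 H2] := runP (s := s) (K := K) (i := s i); first by rewrite full_perm.
split=> [|[|e] le] //; rewrite iterSr //.
exact: H2.
Qed.

Lemma run_gt0 s K i : ~~ full s K i -> (0 < run s K i) = (s i \in K).
Proof.
move=> nf; case Ki: (s i \in K); first by rewrite run_perm.
by rewrite (_ : run s K i = 0) //; apply: runE => //; split=> //=; rewrite Ki.
Qed.

Lemma run_perm_inv s K i : ~~ full s K i -> i \in K ->
  run (s^-1)%g K (s i) = (run (s^-1)%g K i).+1.
Proof.
by move=> nf Ki; rewrite run_perm ?permK // full_inv full_perm.
Qed.

Lemma run_iter s K e i : ~~ full s K i -> i \in K -> e <= run s K i ->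
  [/\ iter e s i \in K, run s K (iter e s i) = run s K i - e &
      run (s^-1)%g K (iter e s i) = run (s^-1)%g K i + e].
Proof.
move=> nf Ki; elim: e => [|e IH] le; first by rewrite subn0 addn0.
have [Kj q p] := IH (ltnW le); set j := iter e s i in Kj q p *.
have nfj : ~~ full s K j by rewrite full_iter.
have Ksj : s j \in K by rewrite -run_gt0 // q subn_gt0.
split=> //; last by rewrite run_perm_inv // p addnS.
by have := run_perm nfj Ksj; rewrite q iterS -/j; lia.
Qed.

(* The reflection of the maximal segment of the [s]-orbit of [i] inside [K]. *)
Definition refl s K i := iter (run (s^-1)%g K i) (s^-1)%g (iter (run s K i) s i).

(** [refl] walks to the end of the segment, then back by the old backward distance; [run_iter]
    tracks both distances through each walk. *)
Lemma reflP s K i : ~~ full s K i -> i \in K ->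
  [/\ ~~ full s K (refl s K i), refl s K i \in K,
      run s K (refl s K i) = run (s^-1)%g K i &
      run (s^-1)%g K (refl s K i) = run s K i].
Proof.
move=> nf Ki; have [Kj q p] := run_iter nf Ki (leqnn _).
set j := iter _ s i in Kj q p.
have nfj : ~~ full (s^-1)%g K j by rewrite full_inv full_iter.
have [|K2 q2 p2] := run_iter (e := run (s^-1)%g K i) nfj Kj.
  by rewrite p leq_addr.
rewrite invgK in p2; split=> //.
- by rewrite -full_inv full_iter.
- by rewrite p2 q subnn.
- by rewrite q2 p addKn.
Qed.

Lemma reflK s K i : ~~ full s K i -> i \in K -> refl s K (refl s K i) = i.
Proof.
move=> nf Ki; have [_ _ q p] := reflP nf Ki.
rewrite {1}/refl q p /refl.
have := @iter_permK _ (s^-1)%g (run (s^-1)%g K i); rewrite invgK => ->.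
exact: iter_permK.
Qed.

Lemma refl_perm s K i : ~~ full s K i -> i \in K -> s i \in K ->
  refl s K (s i) = (s^-1)%g (refl s K i).
Proof.
move=> nf Ki Ksi; rewrite /refl run_perm_inv // (run_perm nf Ksi).
by rewrite iterS iterSr.
Qed.

End Runs.

(** * The involution exchanging the values k and k+1 on a colored permutation *)

Section Swap.
Variables (T : finType) (k : nat).
Implicit Types (s : {perm T}) (c : T -> nat).

(* A letter of absolute value [v], barred iff [b], is encoded by [b + v.*2]. *)
Definition band c : {set T} := [set i | ((c i)./2 == k) || ((c i)./2 == k.+1)].

Definition necklace s c := forall i,
  if odd (c i) then (c (s i))./2 <= (c i)./2 /\ s i != i
  else (c i)./2 <= (c (s i))./2.

(** A step from [i] to [s i] inside a segment is reflected to the step from [(s^-1)%g r] to [r],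
    hence the bar read there. The step leaving the segment is not reflected, so the bar of the last
    letter stays in place. *)
Definition swap s c i :=
  let r := refl s (band c) i in
  if i \notin band c then c i
  else if full s (band c) i then
    (odd (c i) (+) ((c i)./2 != (c (s i))./2)) + (nswap k k.+1 (c i)./2).*2
  else odd (c (if s i \in band c then (s^-1)%g r else i)) +
       (nswap k k.+1 (c r)./2).*2.

Lemma oddb (b : bool) m : odd (b + m.*2) = b.
Proof. by rewrite oddD odd_double addbF; case: b. Qed.

Lemma bandE c i : (i \in band c) = ((c i)./2 == k) || ((c i)./2 == k.+1).
Proof. by rewrite inE. Qed.

Lemma swap_out s c i : i \notin band c -> swap s c i = c i.
Proof. by rewrite /swap => ->. Qed.

Lemma half_swap_full s c i : full s (band c) i ->
  (swap s c i)./2 = nswap k k.+1 (c i)./2.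
Proof. by move=> f; rewrite /swap (full_in f) f half_bit_double. Qed.

Lemma odd_swap_full s c i : full s (band c) i ->
  odd (swap s c i) = odd (c i) (+) ((c i)./2 != (c (s i))./2).
Proof. by move=> f; rewrite /swap (full_in f) f oddb. Qed.

Lemma half_swap_run s c i : i \in band c -> ~~ full s (band c) i ->
  (swap s c i)./2 = nswap k k.+1 (c (refl s (band c) i))./2.
Proof. by move=> Ki /negbTE f; rewrite /swap Ki f half_bit_double. Qed.

Lemma odd_swap_run s c i : i \in band c -> ~~ full s (band c) i ->
  odd (swap s c i) =
  odd (c (if s i \in band c then (s^-1)%g (refl s (band c) i) else i)).
Proof. by move=> Ki /negbTE f; rewrite /swap Ki f oddb. Qed.

Lemma nswap_band v : ((nswap k k.+1 v == k) || (nswap k k.+1 v == k.+1)) =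
  ((v == k) || (v == k.+1)).
Proof. by rewrite /nswap; repeat case: ifP; lia. Qed.

Lemma band_swap s c : band (swap s c) = band c.
Proof.
apply/setP => i; rewrite bandE.
have [Ki|nK] := boolP (i \in band c); last first.
  by rewrite swap_out // -bandE (negbTE nK).
have [f|nf] := boolP (full s (band c) i).
  by rewrite half_swap_full // nswap_band -bandE.
have [_ Kr _ _] := reflP nf Ki.
by rewrite half_swap_run // nswap_band -bandE.
Qed.

Lemma swapK s c : swap s (swap s c) = c.
Proof.
apply: funext => i.
have [Ki|nK] := boolP (i \in band c); last first.
  by rewrite !swap_out // ?band_swap.
rewrite -(odd_double_half (swap s (swap s c) i)) -[RHS]odd_double_half.
have [f|nf] := boolP (full s (band c) i).
  have f' : full s (band c) (s i) by rewrite full_perm.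
  rewrite !(odd_swap_full, half_swap_full) ?band_swap // nswapK.
  rewrite (inj_eq (inv_inj (@nswapK k k.+1))).
  by rewrite -addbA addbb addbF.
rewrite half_swap_run ?band_swap // odd_swap_run ?band_swap //.
have [nfr Kr _ _] := reflP nf Ki.
rewrite half_swap_run // nswapK reflK //; congr (nat_of_bool _ + _).
have [Ksi|nKsi] := boolP (s i \in band c); last first.
  by rewrite odd_swap_run // (negbTE nKsi).
rewrite -refl_perm //; have nfs : ~~ full s (band c) (s i) by rewrite full_perm.
have [nfrs Krs _ _] := reflP nfs Ksi.
rewrite odd_swap_run // reflK // permK {1}refl_perm // permKV Kr.
by [].
Qed.

Lemma nswap_leq u v : (u == k) || (u == k.+1) -> (v == k) || (v == k.+1) ->
  (nswap k k.+1 u <= nswap k k.+1 v) = (v <= u).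
Proof. by rewrite /nswap; repeat case: ifP; lia. Qed.

(** Across the border of a segment the outer value compares in the same way with k and k+1. Inside a
    segment, reflection and exchange of values each reverse the comparison, and the two reversals
    cancel. *)
Lemma necklace_swap s c : necklace s c -> necklace s (swap s c).
Proof.
move=> H i; have Hi := H i.
have [Ki|nK] := boolP (i \in band c); last first.
  rewrite (swap_out s nK); have [Ks|nKs] := boolP (s i \in band c); last first.
    by rewrite (swap_out s nKs).
  have := Ks; rewrite -(band_swap s) bandE; move: nK Ks Hi; rewrite !bandE.
  by move=> nK Ks; case: odd => [[Hi ->]|Hi] Kv; [split=> //|]; lia.
have [f|nf] := boolP (full s (band c) i).
  have f' : full s (band c) (s i) by rewrite full_perm.
  rewrite odd_swap_full // !half_swap_full // !nswap_leq -?bandE //; last first.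
  - exact: full_in f'.
  - exact: full_in f'.
  move: Hi; have [e|] := eqVneq (s i) i; first by rewrite e eqxx addbF; case: odd => // -[].
  by move=> _; case: odd => [[Hi _]|Hi]; case: eqP => /=; try split; lia.
(* A fixed point in the band is a whole cycle in the band. *)
have nei : s i != i.
  apply: contra nf => /eqP e; apply/fullP => m.
  by elim: m => //= m; rewrite -iterS iterSr e.
have nfs : ~~ full s (band c) (s i) by rewrite full_perm.
have [nfr Kr _ _] := reflP nf Ki.
rewrite (odd_swap_run Ki nf) (half_swap_run Ki nf).
have [Ks|nKs] := boolP (s i \in band c); last first.
  rewrite (swap_out s nKs); have := Kr; rewrite bandE -nswap_band; move: nKs Ki Hi; rewrite !bandE.
  by rewrite nei => nKs Ki Hi Kv; move: Hi; case: odd => [[Hi _]|Hi]; [split=> //|]; lia.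
have [_ Krs _ _] := reflP nfs Ks.
rewrite (half_swap_run Ks nfs) -refl_perm // !nswap_leq -?bandE //.
have := H (refl s (band c) (s i)).
rewrite [s (refl _ _ _)](_ : _ = refl s (band c) i); last first.
  by rewrite refl_perm // permKV.
by rewrite nei; case: odd => // -[].
Qed.

Lemma perm_swap s c :
  perm_eq [seq (swap s c i)./2 | i <- enum T]
          [seq nswap k k.+1 v | v <- [seq (c i)./2 | i <- enum T]].
Proof.
pose R i := if (i \in band c) && ~~ full s (band c) i then refl s (band c) i else i.
have RK : involutive R.
  move=> i; rewrite {2}/R; case: ifP => [/andP[Ki nf]|]; rewrite /R.
    by have [-> -> _ _] := reflP nf Ki; rewrite reflK.
  by move=> ->.
have E i : (swap s c i)./2 = nswap k k.+1 (c (R i))./2.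
  rewrite /R; have [Ki|nK] := boolP (i \in band c); last first.
    rewrite swap_out //; move: nK; rewrite bandE /nswap.
    by repeat case: ifP; lia.
  have [f|nf] /= := boolP (full s (band c) i).
    by rewrite half_swap_full.
  by rewrite half_swap_run.
rewrite (eq_map E) -map_comp.
rewrite (map_comp (fun i => nswap k k.+1 (c i)./2) R (enum T)).
apply: perm_map; apply: uniq_perm; rewrite ?enum_uniq //.
  by rewrite map_inj_uniq ?enum_uniq //; apply: inv_inj RK.
move=> i; rewrite mem_enum -[i]RK map_f ?mem_enum //.
Qed.

Lemma sum_odd_swap s c : necklace s c ->
  \sum_i odd (swap s c i) = \sum_i odd (c i).
Proof.
move=> H; rewrite (bigID (full s (band c))) [RHS](bigID (full s (band c))) /=.
congr (_ + _).
  (* With the absolute values added, and shifted by [s] on the right, the sums agree term by term: a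
     barred change of value goes from k+1 to k, an unbarred one from k to k+1. *)
  apply: (@addIn (\sum_(i | full s (band c) i) (c i)./2)).
  rewrite [X in _ = _ + X](reindex_inj (@perm_inj _ s)) /=.
  under [X in _ = _ + X]eq_bigl => i do rewrite full_perm.
  rewrite -!big_split /=; apply: eq_bigr => i f.
  have f' : full s (band c) (s i) by rewrite full_perm.
  have := H i; have := full_in f; have := full_in f'; rewrite !bandE.
  rewrite odd_swap_full //.
  by case: odd; case: eqP => /=; lia.
(* [NF] marks the steps inside a segment; [R] sends the start of such a step to the start of the
   reflected step, where the new bar is read. *)
pose NF i := [&& ~~ full s (band c) i, i \in band c & s i \in band c].
pose R i := if NF i then refl s (band c) (s i) else i.
have NFR i : NF i -> NF (refl s (band c) (s i)).
  case/and3P=> nf Ki Ks; have nfs : ~~ full s (band c) (s i) by rewrite full_perm.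
  have [nfr Krs _ _] := reflP nfs Ks.
  apply/and3P; split=> //; rewrite refl_perm // permKV.
  by have [] := reflP nf Ki.
have RK : involutive R.
  move=> i; rewrite {2}/R; case: ifP => [Ni|]; rewrite /R; last by move=> ->.
  rewrite NFR //; case/and3P: Ni => nf Ki Ks.
  by rewrite [in s _]refl_perm // permKV reflK.
rewrite [RHS](reindex_inj (inv_inj RK)) /=; apply: eq_big => i.
  rewrite /R; case: ifP => // N; case/and3P: (NFR _ N) => -> _ _.
  by case/and3P: N => ->.
move=> nf; congr (nat_of_bool _); rewrite /R /NF nf /=.
have [Ki|nK] /= := boolP (i \in band c); last by rewrite swap_out.
rewrite odd_swap_run //; case: ifP => // Ks.
by rewrite -refl_perm.
Qed.

Definition same_word s c i s2 c2 i2 := forall e, c (iter e s i) = c2 (iter e s2 i2).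

Lemma same_word_iter s c i s2 c2 i2 e : same_word s c i s2 c2 i2 ->
  same_word s c (iter e s i) s2 c2 (iter e s2 i2).
Proof. by move=> H d; rewrite -!iterD. Qed.

(** [swap] consults only the letters along the cycle. Backward steps become forward iterates with
    the same exponent for [s] and [s2], so both reflections are the same iterate. *)
Lemma same_word_swap s c i s2 c2 i2 : same_word s c i s2 c2 i2 ->
  same_word s (swap s c) i s2 (swap s2 c2) i2.
Proof.
suff S j j2 : same_word s c j s2 c2 j2 -> swap s c j = swap s2 c2 j2.
  by move=> H e; apply: S; apply: same_word_iter.
move=> H; have K e : (iter e s j \in band c) = (iter e s2 j2 \in band c2).
  by rewrite !bandE H.
have F : full s (band c) j = full s2 (band c2) j2.
  by apply/fullP/fullP => G e; move: (G e); rewrite K.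
have q : run s (band c) j = run s2 (band c2) j2.
  by apply: eq_find => e; rewrite K.
have p : run (s^-1)%g (band c) j = run (s2^-1)%g (band c2) j2.
  by apply: eq_find => e; rewrite !iter_perm_inv K.
have [r E1 E2] : exists2 r, refl s (band c) j = iter r s j &
    refl s2 (band c2) j2 = iter r s2 j2.
  rewrite /refl q p; exists (run (s2^-1)%g (band c2) j2 * (period T).-1 +
    run s2 (band c2) j2); by rewrite iterD iter_perm_inv.
rewrite /swap E1 E2 !perm_invE -!iterD F (K 0) (K 1) H (H 0) (H 1) /=.
by case: ifP => // _; case: ifP => // _; case: ifP; rewrite ?H ?(H 0).
Qed.

End Swap.

(** * Words as numbers, the first letter being the most significant digit *)

Section Horner.
Variable B : nat.

Fixpoint horner (f : nat -> nat) (m : nat) : nat :=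
  if m is m'.+1 then B * horner f m' + f m' else 0.

Lemma eq_horner f g m : f =1 g -> horner f m = horner g m.
Proof. by move=> E; elim: m => //= m ->; rewrite E. Qed.

Lemma horner_recl f m : horner f m.+1 = f 0 * B ^ m + horner (f \o succn) m.
Proof.
elim: m => [|m IH]; first by rewrite /= muln0 muln1 addn0.
rewrite -[LHS]/(B * horner f m.+1 + f m.+1) IH /= expnS; nia.
Qed.

Lemma horner_lt f m : (forall e, (f e).+1 < B) -> 0 < m -> (horner f m).+1 < B ^ m.
Proof.
move=> H; elim: m => // -[_ _|m IH _]; first by rewrite /= muln0 add0n.
rewrite -[horner f m.+2]/(B * horner f m.+1 + f m.+1) expnS.
by have := IH isT; have := H m.+1; nia.
Qed.

End Horner.

(** * Relabelling the points in the order of their new words *)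

Section Resort.
Variable n : nat.
Implicit Types (s t : 'S_n) (c : 'I_n -> nat).

Definition standard s c :=
  (forall x y : 'I_n, x < y -> c y < c x \/ c x = c y /\ s x < s y) /\
  necklace s c.

(** No letter reaches the top digit [(base c).-1]. This excludes the ambiguity of repeating top
    digits, which would let two points with different first letters satisfy [key_perm] with equal
    keys. *)
Definition base c := (\max_x c x).+2.

(* The word read along the cycle of [x], as a number in base [base c]. *)
Definition key s c x := horner (base c) (fun e => c (iter e s x)) (period 'I_n).

Lemma key_lt s c x : (key s c x).+1 < base c ^ period 'I_n.
Proof.
apply: horner_lt; last exact: period_gt0.
by move=> e; rewrite !ltnS; apply: leq_bigmax.
Qed.

(** Both sides read [period.+1] letters from [x]: the last letter is [c x] again by periodicity, and
    dropping the first leaves the word of [s x]. *)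
Lemma key_perm s c x :
  base c * key s c x + c x = c x * base c ^ period 'I_n + key s c (s x).
Proof.
have := horner_recl (base c) (fun e => c (iter e s x)) (period 'I_n).
rewrite /= iter_period => ->; congr (_ + _).
by apply: eq_horner => e /=; rewrite -iterS iterSr.
Qed.

Lemma key_ltP s c x y : key s c x < key s c y ->
  c x < c y \/ c x = c y /\ key s c (s x) < key s c (s y).
Proof.
have := key_perm s c x; have := key_perm s c y.
have := key_lt s c (s x); have := key_lt s c (s y).
have : 1 < base c by [].
move: (base c ^ period 'I_n) (base c) => M B.
by case: (ltngtP (c x) (c y)); [left|nia|right; split => //; nia].
Qed.

Lemma key_eqP s c x y : key s c x = key s c y ->
  c x = c y /\ key s c (s x) = key s c (s y).
Proof.
have := key_perm s c x; have := key_perm s c y.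
have := key_lt s c (s x); have := key_lt s c (s y).
have : 1 < base c by [].
move: (base c ^ period 'I_n) (base c) => M B.
by case: (ltngtP (c x) (c y)); [nia|nia|move=> -> *; split => //; nia].
Qed.

Lemma key_same_word s c x y : key s c x = key s c y <-> same_word s c x s c y.
Proof.
split=> [H e|H]; last exact: eq_horner.
suff [] : c (iter e s x) = c (iter e s y) /\
  key s c (iter e s x) = key s c (iter e s y) by [].
elim: e => [|e [_ IH]]; first by have [] := key_eqP H.
by have [_ H'] := key_eqP IH; split=> //; have [] := key_eqP H'.
Qed.

Lemma key_standard s c (x y : 'I_n) :
  standard s c -> x < y -> key s c y <= key s c x.
Proof.
move=> [H _] lxy; rewrite leqNgt; apply/negP => lk.
(* The two orders pull the letters in opposite directions, so the letters agree and both
   inequalities pass to the images; thus the words coincide. *)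
have G e : iter e s x < iter e s y /\ key s c (iter e s x) < key s c (iter e s y).
  elim: e => //= e [l1 l2]; case: (key_ltP l2) => [|[E l3]].
    by case: (H _ _ l1) => [|[->]]; lia.
  by split=> //; case: (H _ _ l1) => [|[]] //; rewrite E ltnn.
suff E : key s c x = key s c y by rewrite E ltnn in lk.
apply/key_same_word => e; have [l1 l2] := G e.
by case: (key_ltP l2) => [|[//]]; case: (H _ _ l1) => [|[-> _]]; lia.
Qed.

(** Since [rev_ord x < n], decreasing score means decreasing key, with ties in increasing order of
    the points. *)
Definition score s c (x : 'I_n) := key s c x * n + rev_ord x.

Lemma score_lt s c x y : (score s c y < score s c x) =
  (key s c y < key s c x) || (key s c y == key s c x) && (x < y).
Proof.
have lx := ltn_ord x; have ly := ltn_ord y.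
rewrite /score /=; move: (key s c x) (key s c y) => p q.
apply/idP/idP; first by case: (ltngtP q p) => //=; nia.
by case/orP => [|/andP[/eqP ->]]; nia.
Qed.

Lemma score_inj s c : injective (score s c).
Proof.
move=> x y E; apply: val_inj; have := score_lt s c x y.
have := score_lt s c y x; rewrite E ltnn.
by case: (ltngtP (key s c x) (key s c y)) => //= _; case: ltngtP.
Qed.

Lemma perm_rank t x : val (t x) = #|[set y | t y < t x]|.
Proof.
rewrite -(card_imset _ (@perm_inj _ t)).
rewrite (_ : t @: _ = [set z : 'I_n | z < t x]); last first.
  apply/setP => z; rewrite inE; apply/imsetP/idP => [[y]|l].
    by rewrite inE => l ->.
  by exists (t^-1 z)%g; rewrite ?inE permKV.
rewrite -sum1dep_card -(big_ord_widen _ (fun=> 1)); last exact: ltnW.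
by rewrite sum1_card card_ord.
Qed.

Lemma perm_rank_uniq (t u : 'S_n) :
  (forall x y : 'I_n, (t x < t y) = (u x < u y)) -> t = u.
Proof.
move=> H; apply/permP => x; apply: val_inj; rewrite [LHS]perm_rank [RHS]perm_rank.
by apply: eq_card => y; rewrite !inE H.
Qed.

Lemma rank_exists (f : 'I_n -> nat) : injective f ->
  exists t : 'S_n, forall x y : 'I_n, (t x < t y) = (f y < f x).
Proof.
move=> fi; pose A x := [set y | f x < f y].
have lt_A x : #|A x| < n.
  rewrite -[X in _ < X]card_ord -cardsT; apply: proper_card.
  by apply/properP; split; [exact: finset.subsetT|exists x; rewrite !inE ?ltnn].
have A_lt x y : f y < f x -> #|A x| < #|A y|.
  move=> l; apply: proper_card; apply/properP; split.
    by apply/fintype.subsetP => z; rewrite !inE; apply: ltn_trans.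
  by exists x; rewrite !inE ?ltnn.
pose r x := Ordinal (lt_A x).
have ri : injective r.
  move=> x y /(congr1 val) /= E; apply: fi.
  by case: (ltngtP (f x) (f y)) => // /A_lt; rewrite E ltnn.
exists (perm ri) => x y; rewrite !permE /=.
case: (ltngtP (f y) (f x)) => [/A_lt //|/A_lt|/fi ->]; last by rewrite ltnn.
by case: ltngtP.
Qed.

(** The default [1%g] is never taken, by [rank_exists] and injectivity of [score]. *)
Definition rank s c : 'S_n :=
  odflt 1%g [pick t : 'S_n |
    [forall x, forall y, (t x < t y) == (score s c y < score s c x)]].

Lemma rankE s c x y : (rank s c x < rank s c y) = (score s c y < score s c x).
Proof.
rewrite /rank; case: pickP => [t /forallP/(_ x)/forallP/(_ y)/eqP //|H].
have [t Ht] := rank_exists (@score_inj s c).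
by case/negP: (H t); apply/forallP => u; apply/forallP => v; rewrite Ht.
Qed.

Definition sorter k s c := rank s (swap k s c).
Definition resort_perm k s c : 'S_n := (s ^ sorter k s c)%g.
Definition resort_word k s c : 'I_n -> nat :=
  fun x => swap k s c ((sorter k s c)^-1%g x).

Lemma resort_wordE k s c x :
  resort_word k s c (sorter k s c x) = swap k s c x.
Proof. by rewrite /resort_word permK. Qed.

Lemma iter_conj s t e x : iter e (s ^ t)%g (t x) = t (iter e s x).
Proof. by elim: e => //= e ->; rewrite permJ. Qed.

Lemma necklace_conj s t c c2 : (forall x, c2 (t x) = c x) ->
  necklace s c -> necklace (s ^ t)%g c2.
Proof.
move=> E H i; rewrite -[i](permKV t) permJ !E (inj_eq perm_inj); exact: H.
Qed.

Lemma standard_resort k s c : standard s c ->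
  standard (resort_perm k s c) (resort_word k s c).
Proof.
move=> Hs; have [H N] := Hs; split; last first.
  exact: necklace_conj (resort_wordE k s c) (necklace_swap k N).
move=> x y; rewrite -[x](permKV (sorter k s c)) -[y](permKV (sorter k s c)).
move: ((sorter k s c)^-1%g x) ((sorter k s c)^-1%g y) => {}x {}y.
rewrite !resort_wordE !permJ !rankE !score_lt.
case/orP => [/key_ltP[|[-> ->]]|/andP[/eqP E lxy]]; [by left|by right|right].
have [E1 E2] := key_eqP E; split=> //; rewrite E2 eqxx ltnn /=.
(* In a tie of the new words, swapping back gives a tie of the old ones, where [standard s c] orders
   the images. *)
have : same_word s c x s c y.
  have := same_word_swap k (proj1 (key_same_word s (swap k s c) x y) (esym E)).
  by rewrite swapK.
by move/(_ 0) => /= Ec; case: (H _ _ lxy) => [|[]] //; rewrite Ec ltnn.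
Qed.

Lemma same_word_conj s t c c2 x : (forall x, c2 (t x) = c x) ->
  same_word s c x (s ^ t)%g c2 (t x).
Proof. by move=> E e; rewrite iter_conj E. Qed.

Lemma key_conj s t c c2 x : (forall x, c2 (t x) = c x) ->
  key (s ^ t)%g c2 (t x) = key s c x.
Proof.
move=> E; rewrite /key (_ : base c2 = base c).
  by apply: eq_horner => e; rewrite (same_word_conj _ _ E).
rewrite /base (reindex_inj (@perm_inj _ t)) /=; congr _.+2.
by apply: eq_bigr => i _; rewrite E.
Qed.

Lemma resortK k s c : standard s c ->
  resort_perm k (resort_perm k s c) (resort_word k s c) = s /\
  resort_word k (resort_perm k s c) (resort_word k s c) = c.
Proof.
move=> Hs; have [H N] := Hs; set s1 := resort_perm k s c.
set c1 := resort_word k s c; set t := sorter k s c.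
have E x : c1 (t x) = swap k s c x by exact: resort_wordE.
have E2 x : swap k s1 c1 (t x) = c x.
  rewrite -[in RHS](swapK k s c); symmetry.
  exact: (same_word_swap k (same_word_conj s x E) 0).
set u := sorter k s1 c1.
(* [u] sorts by the keys of [c], which already decrease along the points, and breaks ties by [t],
   which keeps the old order there; so the product preserves the order. *)
have tu : (t * u)%g = 1%g.
  apply: perm_rank_uniq => x y; rewrite !permM !perm1 rankE score_lt.
  rewrite !(key_conj _ _ E2).
  have S a b : key s c a = key s c b -> (t a < t b) = (a < b).
    move/key_same_word/(same_word_swap k)/key_same_word => e.
    by rewrite rankE score_lt e ltnn eqxx.
  case: (ltngtP x y) => [l|l|/val_inj ->]; last by rewrite !ltnn andbF.
    have := key_standard Hs l; rewrite leq_eqVlt => /orP[/eqP e|-> //].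
    by rewrite e eqxx S // l orbT.
  have := key_standard Hs l; rewrite leq_eqVlt => /orP[/eqP e|].
    by rewrite e ltnn eqxx S // ltnNge ltnW.
  by case: ltngtP.
split; first by rewrite /s1 /resort_perm -/c1 -/s1 -/u -/t -conjgM tu conjg1.
apply: funext => x; have := resort_wordE k s1 c1 (t x); rewrite E2 -/u => <-.
by congr (resort_word k s1 c1 _); rewrite -permM tu perm1.
Qed.

Lemma perm_resort k s c :
  perm_eq [seq (resort_word k s c i)./2 | i <- enum 'I_n]
          [seq nswap k k.+1 v | v <- [seq (c i)./2 | i <- enum 'I_n]].
Proof.
apply: perm_trans (perm_swap k s c); rewrite /resort_word.
rewrite (map_comp (fun i => (swap k s c i)./2) (sorter k s c)^-1%g).
apply: perm_map; apply: uniq_perm; rewrite ?enum_uniq //.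
  by rewrite map_inj_uniq ?enum_uniq //; apply: perm_inj.
by move=> i; rewrite mem_enum -[i](permK (sorter k s c)) map_f ?mem_enum.
Qed.

Lemma sum_odd_resort k s c : standard s c ->
  \sum_i odd (resort_word k s c i) = \sum_i odd (c i).
Proof.
case=> _ /(sum_odd_swap k) <-.
rewrite (reindex_inj (@perm_inj _ (sorter k s c))) /=.
by apply: eq_bigr => i _; rewrite resort_wordE.
Qed.

End Resort.

(** * Standard colorings correspond to admissible sequences *)

Section Words.
Variable n : nat.
Implicit Types (s : 'S_n) (c : 'I_n -> nat) (t : n.-tuple nat).

Lemma pos_nextE (i : 'I_n.-1) : pos_next i = i.+1 :> nat.
Proof. by rewrite /= modn_small //; have := ltn_ord i; lia. Qed.

Lemma mem_pos_Exc s (x : 'I_n) : (x \in [set pos e | e in Exc s]) = (x < s x).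
Proof.
apply/imsetP/idP => [[e]|l]; first by rewrite inE => l ->.
have lx : x < n.-1 by have := ltn_ord (s x); lia.
have E : pos (Ordinal lx) = x by apply: val_inj.
by exists (Ordinal lx); rewrite ?inE E.
Qed.

Lemma excE s : exc s = \sum_(x : 'I_n) (x < s x).
Proof.
have pos_inj : injective (@pos n) by move=> x y /(congr1 val) /= /val_inj.
rewrite /exc -(card_imset _ pos_inj) -sum1_card big_mkcond /=.
by apply: eq_bigr => x _; rewrite mem_pos_Exc; case: (x < s x).
Qed.

Lemma mem_Exd s (i : 'I_n.-1) (x y : 'I_n) : x = pos i -> y = pos_next i ->
  (i \in Exd s) = if (x < s x) == (y < s y) then s y < s x else y < s y.
Proof.
move=> -> ->; rewrite inE /bar_word ltxi_pair !mem_pos_Exc !leEbool ltEord.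
by do 2!case: (_ < _).
Qed.

Definition word s t (x : 'I_n) := (x < s x) + (tnth t x).*2.

Lemma half_word s t x : (word s t x)./2 = tnth t x.
Proof. exact: half_bit_double. Qed.

Lemma odd_word s t x : odd (word s t x) = (x < s x).
Proof. exact: oddb. Qed.

Lemma standard_word s t : admissible (Exd s) t -> standard s (word s t).
Proof.
move=> [t1 t2].
(* An equality of [t] at adjacent places forbids an element of [Exd s]: either the bars agree and
   the images increase, or only the first letter is barred. *)
have adj (x y : 'I_n) : y = x.+1 :> nat ->
    word s t y < word s t x \/ word s t x = word s t y /\ s x < s y.
  move=> Exy; have lx : x < n.-1 by have := ltn_ord y; lia.
  pose i := Ordinal lx; have Ex : x = pos i by apply: val_inj.
  have Ey : y = pos_next i by apply: ord_inj; rewrite pos_nextE.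
  have := t1 i; have := t2 i; rewrite (mem_Exd s Ex Ey) -Ex -Ey /word.
  case: (ltngtP (s x) (s y)) => [l|l|/val_inj/perm_inj E]; last by move: Exy; rewrite E; lia.
    by do 2!case: (_ < _) => //=; lia.
  by do 2!case: (_ < _) => //=; lia.
have mono d (x y : 'I_n) : y = x + d.+1 :> nat ->
    word s t y < word s t x \/ word s t x = word s t y /\ s x < s y.
  elim: d y => [|d IH] y Exy; first by apply: adj; lia.
  have lz : x + d.+1 < n by have := ltn_ord y; lia.
  have := IH (Ordinal lz) erefl.
  have : nat_of_ord y = (Ordinal lz).+1 by rewrite Exy /=; lia.
  by move/adj; lia.
have tmono (x y : 'I_n) : x < y -> tnth t y <= tnth t x.
  move=> lxy; have Exy : nat_of_ord y = x + (y - x).-1.+1 by lia.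
  rewrite -(half_word s t x) -(half_word s t y); apply: half_leq.
  by have := mono _ _ _ Exy; lia.
split=> [x y lxy|x]; first by apply: (mono (y - x).-1); lia.
rewrite odd_word !half_word.
case: (ltngtP x (s x)) => [l|l|/val_inj <- //]; last exact: tmono.
by split; [exact: tmono|apply: contraTneq l => ->; rewrite ltnn].
Qed.

(** If [x] is barred but [s x < x], the necklace condition forces a tie, so [s x] is again barred
    and moves down: an infinite descent. An unbarred [x] with [x < s x] gives an infinite ascent. *)
Lemma odd_standard s c x : standard s c -> odd (c x) = (x < s x).
Proof.
move=> [H N]; apply/idP/idP.
  elim: {x}_.+1 {-2}x (ltnSn x) => // m IH x lm ox.
  rewrite ltnNge; apply/negP => le.
  have := N x; rewrite ox => -[lev ne].
  have lt : s x < x by rewrite ltn_neqAle le andbT (inj_eq val_inj).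
  have [l|[e l]] := H _ _ lt.
    by move: lev l; rewrite -(odd_double_half (c x)) -(odd_double_half (c (s x))) ox
      !half_bit_double; case: odd; lia.
  have := IH (s x) (leq_trans lt lm); rewrite e ox => /(_ isT); lia.
move=> l; apply: contraT => /negbTE.
elim: {x}(n - x) {-2}x (leqnn (n - x)) l => [|m IH] x lm l ox.
  by have := ltn_ord x; lia.
have := N x; rewrite ox => lev.
have [l'|[e l']] := H _ _ l.
  by move: lev l'; rewrite -(odd_double_half (c x)) -(odd_double_half (c (s x))) ox
    !half_bit_double; lia.
by apply: (IH (s x)) => //; [lia|rewrite -e].
Qed.

Definition abs_tuple c : n.-tuple nat := [tuple (c i)./2 | i < n].

Lemma admissible_standard s c : standard s c -> admissible (Exd s) (abs_tuple c).
Proof.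
move=> Hs; have [H N] := Hs.
have lt (i : 'I_n.-1) : pos i < pos_next i by rewrite pos_nextE.
split=> i; rewrite !tnth_mktuple.
  by apply: half_leq; have := H _ _ (lt i); lia.
rewrite (mem_Exd s erefl erefl) -!(odd_standard _ Hs).
have := H _ _ (lt i); move: (pos i) (pos_next i) => x y.
rewrite -{1 2 3}(odd_double_half (c x)) -{1 2 3}(odd_double_half (c y)).
rewrite !oddb.
by case: (odd (c x)); case: (odd (c y)) => /=; lia.
Qed.

(** Whatever the descent set, an admissible sequence is the decreasing sort of its values. *)
Lemma admissible_uniq (S S' : {set 'I_n.-1}) t t' :
  admissible S t -> admissible S' t' -> perm_eq t t' -> t = t'.
Proof.
have G (S0 : {set 'I_n.-1}) u : admissible S0 u -> sorted geq u.
  move=> [H _]; apply/(sortedP 0) => i; rewrite size_tuple => li.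
  have li' : i < n.-1 by lia.
  have := H (Ordinal li'); rewrite !(tnth_nth 0) pos_nextE /=; lia.
move=> /G H1 /G H2 E; apply: val_inj.
apply: (sorted_eq _ _ H1 H2 E); first by move=> x y z /=; lia.
by move=> x y /=; lia.
Qed.

Lemma standard_uniq s c c' : standard s c -> standard s c' ->
  perm_eq (abs_tuple c) (abs_tuple c') -> c = c'.
Proof.
move=> H H' E; apply: funext => x.
have := admissible_uniq (admissible_standard H) (admissible_standard H') E.
move/(congr1 (fun t => tnth t x)); rewrite !tnth_mktuple => e.
rewrite -(odd_double_half (c x)) -(odd_double_half (c' x)) e.
by rewrite (odd_standard _ H) (odd_standard _ H').
Qed.

Lemma abs_tuple_word s t : abs_tuple (word s t) = t.
Proof. by apply: eq_from_tnth => i; rewrite tnth_mktuple half_word. Qed.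

Lemma cycle_type_conj s (t : 'S_n) : cycle_type (s ^ t)%g = cycle_type s.
Proof.
have porbit_conj x : porbit (s ^ t)%g (t x) = t @: porbit s x.
  apply/setP => y; apply/porbitP/imsetP => [[i ->]|[z /porbitP[i ->] ->]].
    exists ((s ^+ i)%g x); first exact: mem_porbit.
    by rewrite -conjXg permJ.
  by exists i; rewrite -conjXg permJ.
pose F (C : {set 'I_n}) := t @: C.
have Fi : injective F by apply: imset_inj; apply: perm_inj.
have E : porbits (s ^ t)%g = F @: porbits s.
  apply/setP => C; apply/imsetP/imsetP => [[x _ ->]|[D /imsetP[x _ ->] ->]].
    exists (porbit s (t^-1 x)%g); first exact: imset_f.
    by rewrite /F -porbit_conj permKV.
  by exists (t x) => //; rewrite porbit_conj.
apply/perm_sortP; [by move=> x y /=; lia|by move=> x y z /=; lia|by move=> x y /=; lia|].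
have -> : [seq #|C| | C : {set 'I_n} in porbits s] =
    [seq #|pred_of_set C| | C <- [seq F C | C <- enum (porbits s)]].
  rewrite -map_comp; apply: eq_map => C /=.
  by rewrite /F card_imset //; apply: perm_inj.
apply: perm_map; apply: uniq_perm; rewrite ?enum_uniq //.
  by rewrite map_inj_uniq ?enum_uniq.
move=> C; rewrite mem_enum E; apply/imsetP/mapP => -[D HD ->].
  by exists D; rewrite ?mem_enum.
by exists D; rewrite // -mem_enum.
Qed.

End Words.
Local Open Scope mset_scope.

(** * From adjacent exchanges of variables to all renamings *)

Lemma rename_vars_seq w (r : seq nat) :
  rename_vars w (seq_mset r) = seq_mset [seq w i | i <- r].
Proof. by apply/eq_seq_msetP; apply: perm_map; apply: perm_eq_seq_mset. Qed.

Lemma rename_vars_comp v w m :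
  rename_vars (v \o w) m = rename_vars v (rename_vars w m).
Proof. by rewrite [rename_vars w m]/rename_vars rename_vars_seq -map_comp. Qed.

Lemma eq_rename_vars v w (m : {mset nat}) :
  {in m : seq nat, v =1 w} -> rename_vars v m = rename_vars w m.
Proof. by move=> E; congr seq_mset; apply/eq_in_map. Qed.

Section Invariance.
Variable f : {mset nat} -> int.
Hypothesis f_adjacent : forall k m, f (rename_vars (nswap k k.+1) m) = f m.

Lemma invariant_nswap a b m : f (rename_vars (nswap a b) m) = f m.
Proof.
have lt d c m0 : f (rename_vars (nswap c (c + d)) m0) = f m0.
  elim: d m0 => [|d IH] m0.
    congr f; rewrite (@eq_rename_vars _ id); last first.
      by move=> x _; rewrite /nswap addn0; case: eqP.
    by rewrite /rename_vars map_id seq_mset_id.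
  (* For [d > 0], the exchange of [c] and [c + d.+1] is that of [c] and [c + d] conjugated by an
     adjacent exchange. *)
  have [-> |d0] := eqVneq d 0; first by rewrite addn1.
  rewrite -[RHS](f_adjacent (c + d)) -[RHS]IH -[RHS](f_adjacent (c + d)).
  rewrite -!rename_vars_comp; congr f; apply: eq_rename_vars => x _ /=.
  by rewrite /nswap; repeat case: ifP; lia.
have [le|le] := leqP a b; first by rewrite -(subnKC le).
rewrite (@eq_rename_vars _ (nswap b a)); first by rewrite -(subnKC (ltnW le)).
by move=> x _; rewrite /nswap; repeat case: ifP; lia.
Qed.

Lemma invariant_injective w m : injective w -> f (rename_vars w m) = f m.
Proof.
move=> wi; suff [g [_ gf gw]] : exists g : nat -> nat,
    [/\ injective g, forall m, f (rename_vars g m) = f m & {in m : seq nat, w =1 g}].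
  by rewrite (eq_rename_vars gw).
elim: (m : seq nat) => [|x r [g [gi gf gw]]].
  exists id; split=> // m'; congr f.
  by rewrite /rename_vars map_id seq_mset_id.
(* The new exchange corrects the image of [x]; injectivity of [g] and [w] protects the variables
   already matched. *)
exists (nswap (g x) (w x) \o g); split.
- by apply: inj_comp gi; apply: inv_inj; apply: nswapK.
- by move=> m'; rewrite rename_vars_comp invariant_nswap.
move=> y; rewrite inE => /orP[/eqP ->|yr] /=; first by rewrite /nswap eqxx.
rewrite -(gw y yr) /nswap; case: eqP => [e|_].
  by have /gi -> : g y = g x by rewrite -gw.
by case: eqP => // /wi <-; rewrite gw.
Qed.

End Invariance.

(** * Coefficients as numbers of permutations, and their symmetry *)

Section Coefficients.
Variable n : nat.
Implicit Types (s : 'S_n) (S : {set 'I_n.-1}) (m : {mset nat}).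

Lemma FseriesE S m : Fseries S m =
  (`[< exists t : n.-tuple nat, admissible S t /\ seq_mset t = m >]%:R)%R.
Proof.
rewrite /Fseries; case: asboolP => [[t [tS tm]]|H].
  rewrite -(@fsbig_widen _ _ _ _ [set t]%classic).
  - by rewrite fsbig_set1 /monomial tm eqxx.
  - by move=> _ ->.
  move=> u [uS ut]; rewrite /= /monomial; case: eqP => // mu; case: ut => /=.
  apply: admissible_uniq uS tS _; apply/eq_seq_msetP; by rewrite -mu tm.
rewrite fsbig1 // => t tS; rewrite /monomial; case: eqP => // mt.
by case: H; exists t.
Qed.

Definition content (c : 'I_n -> nat) : {mset nat} :=
  seq_mset [seq (c i)./2 | i <- enum 'I_n].

Definition contributes m s := exists c, standard s c /\ content c = m.

Lemma contributesP m s : (exists t : n.-tuple nat,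
  admissible (Exd s) t /\ seq_mset t = m) <-> contributes m s.
Proof.
split=> [[t [ts <-]]|[c [cs <-]]].
  exists (word s t); split; first exact: standard_word.
  by rewrite -[in RHS](abs_tuple_word s t).
by exists (abs_tuple c); split=> //; apply: admissible_standard.
Qed.

Definition contributors la j m : {set 'S_n} :=
  [set s | [&& cycle_type s == la, exc s == j & `[< contributes m s >]]].

Lemma QseriesE la j m : Qseries n la j m = (#|contributors la j m|%:R)%R.
Proof.
rewrite /Qseries fct_sumE -sum1_card GRing.natr_sum big_mkcond [RHS]big_mkcond /=.
apply: eq_bigr => s _; rewrite inE andbA FseriesE.
rewrite (asbool_equiv_eq (contributesP m s)).
by case: (_ && _); case: asbool.
Qed.

Lemma content_resort k s c :
  content (resort_word k s c) = rename_vars (nswap k k.+1) (content c).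
Proof.
by rewrite /content rename_vars_seq; apply/eq_seq_msetP; apply: perm_resort.
Qed.

Lemma exc_standard s c : standard s c -> exc s = \sum_i odd (c i).
Proof.
by move=> H; rewrite excE; apply: eq_bigr => x _; rewrite (odd_standard _ H).
Qed.

Lemma leq_contributors la j m k :
  #|contributors la j m| <= #|contributors la j (rename_vars (nswap k k.+1) m)|.
Proof.
pose C s c := standard s c /\ content c = m.
(* One coloring is chosen per contributor; the constant 0 is a default elsewhere. *)
have /choice [cw cwP] s : exists c, s \in contributors la j m -> C s c.
  have [|_] := boolP (s \in contributors la j m); last by exists (fun=> 0).
  by rewrite inE => /and3P[_ _ /asboolP[c Hc]]; exists c.
pose g s := resort_perm k s (cw s).
suff gi : {in contributors la j m &, injective g}.
  rewrite -(card_in_imset gi).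
  apply/subset_leq_card/fintype.subsetP => _ /imsetP[s Hs ->].
  have [st cm] := cwP s Hs; move: Hs; rewrite !inE => /and3P[/eqP <- /eqP <- _].
  have st' := standard_resort k st.
  rewrite /g cycle_type_conj eqxx (exc_standard st') (exc_standard st).
  rewrite sum_odd_resort // eqxx; apply/asboolP.
  by exists (resort_word k s (cw s)); rewrite content_resort cm.
move=> s1 s2 H1 H2 E; have [st1 cm1] := cwP _ H1; have [st2 cm2] := cwP _ H2.
have [<- _] := resortK k st1; have [<- _] := resortK k st2.
(* The two resorted colorings are standard for the same permutation and have the same content, so
   they coincide and [resortK] recovers the same source. *)
rewrite -/(g s1) -/(g s2) E; congr (resort_perm k _ _).
have st1' := standard_resort k st1; rewrite -/(g s1) E in st1'.
apply: (standard_uniq st1' (standard_resort k st2)).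
apply/eq_seq_msetP; rewrite -[LHS]/(content _) -[RHS]/(content _).
by rewrite !content_resort cm1 cm2.
Qed.

Lemma Qseries_adjacent la j k m :
  Qseries n la j (rename_vars (nswap k k.+1) m) = Qseries n la j m.
Proof.
rewrite !QseriesE; congr (_%:R)%R; apply/eqP.
rewrite eqn_leq leq_contributors andbT.
(* The reverse inequality is the same one at the renamed monomial, since the exchange is an
   involution. *)
have := leq_contributors la j (rename_vars (nswap k k.+1) m) k.
suff -> : rename_vars (nswap k k.+1) (rename_vars (nswap k k.+1) m) = m by [].
rewrite -rename_vars_comp (@eq_rename_vars _ id) => [|x _ /=].
  by rewrite /rename_vars map_id seq_mset_id.
exact: nswapK.
Qed.

End Coefficients.

Theorem theorem5p4 (n : nat) (la : seq nat) (j : nat) :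
  is_partition_of n la -> j < n -> symmetric_function (Qseries n la j).
Proof.
move=> _ _; split=> [|w wb m].
  (* Every contributing monomial is the content of a coloring of n points, hence has degree n. *)
  exists n => m nm; rewrite QseriesE; apply/eqP.
  suff -> : contributors n la j m = finset.set0 by rewrite cards0.
  apply/setP => s; rewrite !inE; apply/negbTE/negP => /and3P[_ _ /asboolP[c [_ E]]].
  have := perm_size (perm_eq_seq_mset [seq (c i)./2 | i <- enum 'I_n]).
  rewrite -/(content c) E size_map size_enum_ord => e.
  by move: nm; rewrite e ltnn.
by apply: invariant_injective (bij_inj wb) => k m'; apply: Qseries_adjacent.
Qed.
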